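(* Let $f\in\mathcal M_-$ and let $\lambda>0$ be such that $\mathbf E e^{\lambda d_j}<\infty$ for each $j$. Put $e_j=\mathbf E_{j-1}\left(e^{\lambda d_j}-1-\lambda d_j\right)$, $j=1,2,\ldots$. Then for all $r\ge0$, $$\mathbf{Pr}(f^*_+\ge r)\le e^{-\lambda r}\left\|\prod_{j=1}^\infty(1+e_j)\right\|_\infty\le\exp\left\{-\lambda r+\left\|\sum_{j=1}^\infty e_j\right\|_\infty\right\}.$$
   Context: $\mathcal M_-$ is the set of all real-valued supermartingales $f=(f_0,f_1,\ldots)$ (integrable, with $f_0\equiv0$) on some probability space with respect to some filtration $(F_0,F_1,\ldots)$ (both may depend on $f$). Put $d_j=f_j-f_{j-1}$ for $j\ge1$ and $f^*_+=\sup_{j\ge0}f_j$; $\mathbf E_{j-1}$ is the conditional expectation given $F_{j-1}$; $\|\cdot\|_\infty$ of a random variable is its essential supremum norm (possibly $+\infty$). *)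

(* Defs.v *)
From HB Require Import structures.
From mathcomp Require Import all_boot all_order all_algebra.
From mathcomp Require Import all_classical all_reals all_analysis.

Set Implicit Arguments.
Unset Strict Implicit.
Unset Printing Implicit Defensive.

Import Order.TTheory GRing.Theory Num.Theory.
Import numFieldNormedType.Exports.

Local Open Scope classical_set_scope.
Local Open Scope ring_scope.

(* Sub-sigma-algebras are plain set systems on the carrier, so that several of
   them can live on the same measurable space. *)
Definition measurable_wrt (T : Type) (R : realType) (G : set (set T))
    (X : T -> R) : Prop :=
  forall B : set R, measurable B -> G (X @^-1` B).

Record filtration (d : measure_display) (T : measurableType d)
    (F : nat -> set (set T)) : Prop := Filtration {
  filtration_sigma : forall n, sigma_algebra [set: T] (F n) ;
  filtration_sub : forall n, F n `<=` measurable ;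
  filtration_mono : forall m n, (m <= n)%N -> F m `<=` F n
}.

(* [Y] is a (real-valued) version of the conditional expectation of the
   integrable variable [X] given [G]; versions are a.s. unique. *)
Record is_cond_exp (d : measure_display) (T : measurableType d) (R : realType)
    (P : probability T R) (G : set (set T)) (X Y : T -> R) : Prop :=
    IsCondExp {
  cond_exp_source : P.-integrable [set: T] (EFin \o X) ;
  cond_exp_measurable : measurable_wrt G Y ;
  cond_exp_integrable : P.-integrable [set: T] (EFin \o Y) ;
  cond_exp_integral : forall A, G A ->
    (\int[P]_(w in A) (Y w)%:E = \int[P]_(w in A) (X w)%:E)%E
}.

Record supermartingale (d : measure_display) (T : measurableType d)
    (R : realType) (P : probability T R) (F : nat -> set (set T))
    (f : nat -> T -> R) : Prop := Supermartingale {
  supermartingale_filtration : filtration F ;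
  supermartingale_adapted : forall n, measurable_wrt (F n) (f n) ;
  supermartingale_integrable :
    forall n, P.-integrable [set: T] (EFin \o f n) ;
  supermartingale_le : forall n, exists2 g : T -> R,
    is_cond_exp P (F n) (f n.+1) g & {ae P, forall w, g w <= f n w}
}.

Record Mminus (d : measure_display) (T : measurableType d) (R : realType)
    (P : probability T R) (F : nat -> set (set T)) (f : nat -> T -> R) : Prop :=
    MkMminus {
  Mminus_supermartingale : supermartingale P F f ;
  Mminus0 : forall w, f 0%N w = 0
}.

(* Meaningful for 1 <= j only. *)
Definition increment (T : Type) (R : realType) (f : nat -> T -> R) (j : nat)
    (w : T) : R :=
  f j w - f j.-1 w.

Definition maximal (T : Type) (R : realType) (f : nat -> T -> R) (w : T)
    : \bar R :=
  ereal_sup (range (fun j : nat => (f j w)%:E)).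

(* Infinite product over j >= 1, with values in [0, +oo] when all factors
   are >= 1. *)
Definition infprod1 (R : realType) (u : nat -> R) : \bar R :=
  limn (fun n : nat => (\prod_(1 <= j < n) u j)%:E).

(* Main.v *)
Require Import Defs.
From HB Require Import structures.
From mathcomp Require Import all_boot all_order all_algebra.
From mathcomp Require Import all_classical all_reals all_analysis.

From mathcomp Require Import measurable_realfun ring.

(** The theorem is a Chernoff bound run along the whole trajectory.  Since
    [exp x - 1 - x >= 0], each compensator [e_j] is a.s. nonnegative, and since
    the increments of a supermartingale have nonpositive conditional mean,
      [E_(j-1) exp (lambda d_j) <= 1 + e_j].
    Hence dividing [exp (lambda f_n)] by the predictable product of the
    [1 + e_j], [j <= n], gives a nonnegative supermartingale [M] with [M_0 = 1].
    If the product is a.s. bounded by [C], then [M_n >= exp (lambda s) / C] as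
    soon as [f_n >= s], and the maximal inequality for nonnegative
    supermartingales bounds by [C exp (- lambda s)] the probability that [f]
    ever reaches [s].  The event that the supremum is at least [r] does not
    imply that [r] is reached, but it implies that every [s < r] is; letting
    [s] increase to [r] gives the first inequality.  The second one is
    [1 + x <= exp x], factor by factor.

    The exponential [exp (lambda f_n)] need not be integrable, only its
    quotient [M_n] is, so no conditional expectation of it is ever formed:
    conditional inequalities are written as comparisons of integrals over the
    events of the sub-sigma-algebra, and [le_integral_mul] lets a nonnegative
    weight measurable for that sub-sigma-algebra multiply both sides, with
    integrals allowed to be infinite.  [exp_process_decreasing] is then the
    supermartingale property, [maximal_inequality] the stopping argument, and
    [probability_crossing_le] their combination. *)

Set Implicit Arguments.
Unset Strict Implicit.
Unset Printing Implicit Defensive.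

Import Order.TTheory GRing.Theory Num.Theory.
Import numFieldNormedType.Exports.

Local Open Scope classical_set_scope.
Local Open Scope ring_scope.

(** * Weights measurable for a sub-sigma-algebra *)

Lemma integral_finite_range_mul d (T : measurableType d) (R : realType)
    (mu : {measure set T -> \bar R}) (h X : T -> R) :
  finite_set (range h) -> (forall w, 0 <= h w) ->
  (forall y, measurable (h @^-1` [set y])) ->
  measurable_fun [set: T] X -> (forall w, 0 <= X w) ->
  (\int[mu]_w (h w * X w)%:E =
   \sum_(y \in range h) y%:E * \int[mu]_(w in h @^-1` [set y]) (X w)%:E)%E.
Proof.
move=> finh h0 mh mX X0.
have hyX y w : (0 <= y%:E * ((EFin \o X) \_ (h @^-1` [set y])) w)%E.
  rewrite patchE; case: ifPn => [|_]; last by rewrite mule0.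
  by rewrite inE => <-; rewrite -EFinM lee_fin mulr_ge0.
have mhX y :
    measurable_fun [set: T] ((EFin \o X) \_ (h @^-1` [set y]) : T -> \bar R).
  apply/(measurable_restrictT _ (mh y)); apply/measurable_EFinP.
  exact: measurable_funTS.
transitivity (\int[mu]_w \sum_(y \in range h)
    y%:E * ((EFin \o X) \_ (h @^-1` [set y])) w)%E.
  apply: eq_integral => w _; rewrite (fsbigD1 (h w))//=; last first.
    by exists w.
  rewrite patchE mem_set// fsbig1 ?adde0//= => y [_ /= yhw].
  by rewrite patchE memNset ?mule0// => /= /esym.
rewrite ge0_integral_fsum//; last first.
  by move=> y; exact: measurable_funeM.
apply: eq_fsbigr => y /set_mem[w _ <-].
by rewrite ge0_integralZl_EFin// -?integral_mkcond// => x _; rewrite patchE;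
  case: ifP => //= _; rewrite lee_fin.
Qed.

Section sub_sigma_algebra.
Context d (T : measurableType d) (R : realType) (G : set (set T)).
Hypotheses (sG : sigma_algebra [set: T] G) (Gm : G `<=` measurable).

(** This makes the closure properties of measurable functions available for
    functions measurable with respect to [G]. *)
Lemma measurable_wrtP (X : T -> R) : measurable_wrt G X <->
  measurable_fun [set: g_sigma_algebraType G] (X : g_sigma_algebraType G -> R).
Proof.
split=> [mX _ B mB|mX B mB].
  by rewrite setTI; apply: sub_gen_smallest; exact: mX.
by have := mX measurableT B mB; rewrite setTI measurable_g_measurableTypeE.
Qed.

Lemma measurable_wrt_fun (X : T -> R) :
  measurable_wrt G X -> measurable_fun [set: T] X.
Proof. by move=> mX _ B mB; rewrite setTI; apply/Gm/mX. Qed.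

Import HBNNSimple.

(** The substitute for pulling a known factor out of a conditional expectation:
    [Z] is an increasing limit of [G]-simple functions, for which the claim is a
    nonnegative combination of the hypotheses, and monotone convergence applies
    to both sides without any integrability of the products. *)
Lemma le_integral_mul (mu : {measure set T -> \bar R}) (X Y Z : T -> R) :
  measurable_fun [set: T] X -> (forall w, 0 <= X w) ->
  measurable_fun [set: T] Y -> (forall w, 0 <= Y w) ->
  measurable_wrt G Z -> (forall w, 0 <= Z w) ->
  (forall A, G A ->
    \int[mu]_(w in A) (X w)%:E <= \int[mu]_(w in A) (Y w)%:E)%E ->
  (\int[mu]_w (Z w * X w)%:E <= \int[mu]_w (Z w * Y w)%:E)%E.
Proof.
move=> mX X0 mY Y0 mZ Z0 XY.
have mZ' : measurable_fun [set: g_sigma_algebraType G] (EFin \o Z).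
  by apply/measurable_EFinP/measurable_wrtP.
pose h n := nnsfun_approx measurableT mZ' n.
have Gh n y : G (h n @^-1` [set y]).
  by apply: (measurable_wrtP (h n)).2 => //; exact: measurable_set1.
have hZ w : (h n w)%:E @[n --> \oo] --> (Z w)%:E.
  by apply: cvg_nnsfun_approx => // x _; rewrite lee_fin.
have mh n : measurable_fun [set: T] (h n : T -> R).
  by apply: measurable_wrt_fun; apply/measurable_wrtP.
have lim_h (V : T -> R) : measurable_fun [set: T] V -> (forall w, 0 <= V w) ->
    (\int[mu]_w (h n w * V w)%:E)%E @[n --> \oo] -->
    (\int[mu]_w (Z w * V w)%:E)%E.
  move=> mV V0.
  rewrite (_ : (fun w => (Z w * V w)%:E) =
      fun w => limn (fun n => (h n w * V w)%:E)); last first.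
    apply/funext => w; apply/esym/cvg_lim => //.
    under eq_fun do rewrite EFinM.
    by rewrite EFinM; apply: cvgeZr => //; exact: hZ.
  apply: cvg_monotone_convergence => //.
  - by move=> n; apply/measurable_EFinP; apply: measurable_funM.
  - by move=> n w _; rewrite lee_fin mulr_ge0.
  - move=> w _ m n mn; rewrite lee_fin ler_wpM2r//.
    by have /lefP/(_ w) := nd_nnsfun_approx measurableT mZ' mn.
rewrite -(cvg_lim _ (lim_h _ mX X0))// -(cvg_lim _ (lim_h _ mY Y0))//.
apply: lee_lim; [exact: cvgP (lim_h _ mX X0)|exact: cvgP (lim_h _ mY Y0)|].
apply: nearW => n; have finh : finite_set (range (h n)) by exact: fimfunP.
have mhy y : measurable (h n @^-1` [set y] : set T) by exact/Gm.
rewrite !integral_finite_range_mul//.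
apply: lee_fsum => // y [w _ <-].
by apply: lee_wpmul2l; [rewrite lee_fin|exact: XY].
Qed.

End sub_sigma_algebra.

(** * Conditional expectations and supermartingale increments *)

Section conditional_expectation.
Context d (T : measurableType d) (R : realType).

Lemma ae_le_integral (mu : {measure set T -> \bar R}) (A : set T)
    (X Y : T -> R) : measurable A ->
  mu.-integrable A (EFin \o X) -> mu.-integrable A (EFin \o Y) ->
  {ae mu, forall w, X w <= Y w} ->
  (\int[mu]_(w in A) (X w)%:E <= \int[mu]_(w in A) (Y w)%:E)%E.
Proof.
move=> mA iX iY XY; rewrite -sube_ge0; last first.
  by rewrite (integrable_fin_num mA iX).
rewrite -integralB_EFin//.
have mX := (measurable_EFinP _ _).1 (measurable_int _ iX).
have mY := (measurable_EFinP _ _).1 (measurable_int _ iY).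
rewrite (ae_eq_integral (fun w => (Num.max (Y w - X w) 0)%:E))//.
- by apply: integral_ge0 => w _; rewrite lee_fin le_max lexx orbT.
- by apply/measurable_EFinP; exact: measurable_funB.
- apply/measurable_EFinP; apply: measurable_maxr => //.
  exact: measurable_funB.
- by apply: filterS XY => w XYw _; rewrite max_l// subr_ge0.
Qed.

Variables (P : probability T R) (G : set (set T)).
Hypotheses (sG : sigma_algebra [set: T] G) (Gm : G `<=` measurable).

(** The event [Y < 0] belongs to [G], and over it the integral of [Y], being
    that of [X], is nonnegative; so the event is negligible. *)
Lemma cond_exp_ge0 (X Y : T -> R) : is_cond_exp P G X Y ->
  (forall w, 0 <= X w) -> {ae P, forall w, 0 <= Y w}.
Proof.
move=> [iX mY iY XY] X0.
pose A := Y @^-1` `]-oo, 0[.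
have GA : G A by apply: mY; exact: measurable_itv.
have mA : measurable A by exact: Gm.
have iYA : P.-integrable A (EFin \o Y) by exact: integrableS iY.
have : (\int[P]_(w in A) `|(Y w)%:E| = 0)%E.
  apply/eqP; rewrite eq_le integral_ge0// andbT.
  rewrite (eq_integral (fun w => - (Y w)%:E)%E); last first.
    move=> w; rewrite inE /A /= in_itv/= => Yw0.
    by rewrite ltr0_norm.
  rewrite integralN; last exact: integrable_add_def.
  by rewrite oppe_le0 XY// integral_ge0// => w _; rewrite lee_fin.
move/ae_eq_integral_abs => /(_ mA (measurable_int _ iYA)) Y0.
apply: filterS Y0 => w Yw0; rewrite leNgt; apply/negP => Yw.
have /Yw0[Yw00] : A w by rewrite /A/= in_itv.
by rewrite Yw00 ltxx in Yw.
Qed.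

End conditional_expectation.

Section supermartingale_increments.
Context d (T : measurableType d) (R : realType) (P : probability T R)
  (F : nat -> set (set T)) (f : nat -> T -> R).
Hypothesis smf : supermartingale P F f.

Let mF n A : F n A -> measurable A.
Proof. exact: filtration_sub (supermartingale_filtration smf) _ _. Qed.

Let iS n A : F n A -> forall X, P.-integrable [set: T] X -> P.-integrable A X.
Proof. by move=> /mF mA X; exact: integrableS. Qed.

Lemma supermartingale_integral_le n A : F n A ->
  (\int[P]_(w in A) (f n.+1 w)%:E <= \int[P]_(w in A) (f n w)%:E)%E.
Proof.
move=> FA; have [g [_ _ ig <-// ]] := supermartingale_le smf n.
move=> gf; apply: ae_le_integral gf; first exact: mF FA.
  exact: iS FA _ ig.
exact: iS FA _ (supermartingale_integrable smf n).
Qed.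

(** Decompose [exp x] as [1 + (exp x - 1 - x) + x]: the middle term integrates
    to the compensator and the last one to something nonpositive.  The positive
    part agrees a.s. with [e] and is there so that the bound [1 + max (e, 0)]
    is at least 1 at every point, as division and logarithms require. *)
Lemma integral_expR_increment_le (lambda : R) n (e : T -> R) :
  0 <= lambda ->
  is_cond_exp P (F n)
    (fun w => expR (lambda * increment f n.+1 w) - 1
              - lambda * increment f n.+1 w) e ->
  {ae P, forall w, 0 <= e w} /\
  forall A, F n A ->
    (\int[P]_(w in A) (expR (lambda * increment f n.+1 w))%:E
     <= \int[P]_(w in A) (1 + Num.max (e w) 0)%:E)%E.
Proof.
move=> lambda0 ce.
have e0 : {ae P, forall w, 0 <= e w}.
  apply: (cond_exp_ge0 _ ce); first by move=> A; exact: mF.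
  by move=> w; rewrite subr_ge0 lerBrDl expR_ge1Dx.
split => // A FA; have mA := mF FA.
case: ce => + _ + /(_ _ FA).
set phi := (fun w => _) => iphi ie phie.
have if1 := supermartingale_integrable smf n.+1.
have if0 := supermartingale_integrable smf n.
have idf : P.-integrable [set: T] (EFin \o increment f n.+1).
  exact: integrableB if1 if0.
have ildf : P.-integrable A (EFin \o (fun w => lambda * increment f n.+1 w)).
  exact: iS FA _ (integrableZl measurableT lambda idf).
have i1 : P.-integrable A (EFin \o cst 1).
  exact: finite_measure_integrable_cst.
have df_le0 : (\int[P]_(w in A) (lambda * increment f n.+1 w)%:E <= 0)%E.
  under eq_integral do rewrite EFinM.
  rewrite integralZl//; last exact: iS FA _ idf.
  apply: mule_ge0_le0; first by rewrite lee_fin.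
  under eq_integral do rewrite /increment EFinB.
  rewrite integralB_EFin//; [|exact: iS FA _ if1|exact: iS FA _ if0].
  rewrite sube_le0; exact: supermartingale_integral_le.
have i1p : P.-integrable A (EFin \o (cst 1 \+ phi)).
  exact: integrableD i1 (iS FA iphi).
rewrite (_ : (fun w => (expR _)%:E) = (EFin \o (cst 1 \+ phi)%R)
   \+ (EFin \o (fun w => (lambda * increment f n.+1 w)%R)))%E; last first.
  by apply/funext => w /=; rewrite -!EFinD /phi; congr EFin; ring.
rewrite integralD_EFin//.
apply: (@le_trans _ _ (\int[P]_(w in A) ((EFin \o (cst 1 \+ phi)%R) w))%E).
  by rewrite -[leRHS]adde0; exact: leeD2l.
rewrite (integralD_EFin mA i1 (iS FA iphi)) [X in (_ + X <= _)%E](esym phie).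
rewrite -(integralD_EFin mA i1 (iS FA ie)).
have me := (measurable_EFinP _ _).1 (measurable_int _ (iS FA ie)).
rewrite (ae_eq_integral (fun w => (1 + Num.max (e w) 0)%:E))//.
- apply/measurable_EFinP; exact: measurable_funD.
- apply/measurable_EFinP; apply: measurable_funD => //.
  exact: measurable_maxr.
- by apply: filterS e0 => w ew0 _ /=; rewrite max_l.
Qed.
End supermartingale_increments.

(** * The maximal inequality *)

(** Stop at the first [n] for which [E n] occurs.  The events of stopping
    at [n], [seqDU E n], are disjoint, each contributes at least [c] times its
    measure to the integral of the stopped process, and that integral cannot
    exceed the initial one. *)
Lemma maximal_inequality d (T : measurableType d) (R : realType)
    (mu : {measure set T -> \bar R}) (F : nat -> set (set T))
    (M : nat -> T -> R) (E : nat -> set T) (c : R) :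
  filtration F ->
  (forall n, measurable_fun [set: T] (M n)) -> (forall n w, 0 <= M n w) ->
  (forall n A, F n A -> \int[mu]_(w in A) (M n.+1 w)%:E <=
                        \int[mu]_(w in A) (M n w)%:E)%E ->
  (forall n, F n (E n)) -> 0 <= c ->
  {ae mu, forall w, forall n, E n w -> c <= M n w} ->
  (c%:E * mu (\bigcup_n E n) <= \int[mu]_w (M 0%N w)%:E)%E.
Proof.
move=> filF mM M0 decM FE c0 cM.
have mE n : measurable (E n) by exact/(filtration_sub filF)/FE.
pose B n := \big[setU/set0]_(k < n) E k.
have mB n : measurable (B n) by exact: bigsetU_measurable.
(* On the event of not having stopped by time n, one may pass from time n to
   time n + 1 because that event is already known at time n. *)
have FB n : F n (~` B n.+1).
  rewrite -(measurable_g_measurableTypeE (filtration_sigma filF n)).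
  apply: measurableC; apply: bigsetU_measurable => k _.
  rewrite (measurable_g_measurableTypeE (filtration_sigma filF n)).
  by apply: filtration_mono (FE k); rewrite // -ltnS.
have split_B n (D := E n `\` B n) :
    (\int[mu]_(w in ~` B n) (M n w)%:E =
     \int[mu]_(w in D) (M n w)%:E + \int[mu]_(w in ~` B n.+1) (M n w)%:E)%E.
  have -> : ~` B n = D `|` ~` B n.+1.
    rewrite /B big_ord_recr/= -/(B n) /D; apply/seteqP; split => w/=.
      by have [?|?] := pselect (E n w); [left|right; case].
    by case=> [[]//|/not_orP[]].
  rewrite ge0_integral_setU//.
  - exact: measurableD.
  - exact: measurableC.
  - by apply/measurable_EFinP; exact: measurable_funTS.
  - by move=> w _; rewrite lee_fin.
  - apply/disj_setPS => w [[Ew _]]; rewrite /B big_ord_recr/=.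
    by move/not_orP => [].
have bound n : (\sum_(0 <= k < n) c%:E * mu (seqDU E k) +
    \int[mu]_(w in ~` B n) (M n w)%:E <= \int[mu]_w (M 0%N w)%:E)%E.
  elim: n => [|n IH].
    by rewrite big_nil add0e /B big_ord0 setC0.
  apply: le_trans IH; rewrite big_nat_recr//= -addeA; apply: leeD2l.
  rewrite [leRHS]split_B; apply: leeD; last by apply: decM; exact: FB.
  have mD : measurable (seqDU E n) by exact: seqDU_measurable.
  rewrite -integral_cst//.
  apply: ae_ge0_le_integral => //.
  - by move=> w _; rewrite lee_fin.
  - by apply/measurable_EFinP; exact: measurable_funTS.
  - by apply: filterS cM => w cMw [/cMw cMnw _]; rewrite lee_fin.
rewrite seqDU_bigcup_eq measure_bigcup//; last first.
  by move=> k _; exact: seqDU_measurable.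
rewrite -nneseriesZl; last by move=> *; exact: measure_ge0.
apply: lime_le.
  by apply: is_cvg_nneseries => k _ _; rewrite mule_ge0.
apply: nearW => n; apply: le_trans (bound n).
rewrite (eq_bigl xpredT); last by move=> k; rewrite mem_set.
by rewrite leeDl// integral_ge0// => w _; rewrite lee_fin.
Qed.

(** * Infinite products of factors at least 1 *)

Section infinite_product.
Context (R : realType) (u : nat -> R).
Hypothesis u0 : forall j, (1 <= j)%N -> 0 <= u j.

Lemma prod_add1_ge1 n : 1 <= \prod_(1 <= j < n) (1 + u j).
Proof.
rewrite big_seq; elim/big_ind : _ => //.
  by move=> x y x1 y1; rewrite -[1]mulr1 ler_pM.
by move=> j; rewrite mem_index_iota lerDl => /andP[j1 _]; exact: u0.
Qed.

Let ndprod : nondecreasing_seq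
  (fun n => (\prod_(1 <= j < n) (1 + u j))%:E).
Proof.
apply/nondecreasing_seqP => -[|n]; first by rewrite !big_geq.
rewrite [in leRHS]big_nat_recr//= lee_fin ler_peMr ?lerDl ?u0//.
exact: le_trans (prod_add1_ge1 _).
Qed.

Lemma prod_le_infprod1 n :
  ((\prod_(1 <= j < n) (1 + u j))%:E <= infprod1 (fun j => (1 + u j)%R))%E.
Proof.
rewrite /infprod1; apply: lime_ge; first exact: ereal_nondecreasing_is_cvgn.
by exists n => // m /= nm; exact: ndprod.
Qed.

Lemma infprod1_le_expeR_sum :
  (infprod1 (fun j => (1 + u j)%R) <= expeR (\sum_(1 <= j <oo) (u j)%:E))%E.
Proof.
apply: lime_le; first exact: ereal_nondecreasing_is_cvgn.
apply: nearW => n.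
apply: (@le_trans _ _ (expeR (\sum_(1 <= j < n) (u j)%:E)%E)); last first.
  rewrite lee_expeR; apply: nneseries_lim_ge => j j1 _.
  by rewrite lee_fin u0.
rewrite sumEFin/= lee_fin expR_sum big_seq [leRHS]big_seq.
apply: ler_prod => j; rewrite mem_index_iota => /andP[j1 _].
by rewrite expR_ge1Dx addr_ge0// u0.
Qed.

End infinite_product.

(** * The exponential supermartingale *)

Section exponential_supermartingale.
Context d (T : measurableType d) (R : realType) (P : probability T R)
  (F : nat -> set (set T)) (f : nat -> T -> R) (lambda : R) (e : nat -> T -> R).
Hypotheses (hf : Mminus P F f) (lambda0 : 0 < lambda).
Hypothesis he : forall j : nat, (1 <= j)%N ->
  is_cond_exp P (F j.-1)
    (fun w => expR (lambda * increment f j w) - 1 - lambda * increment f j w)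
    (e j).

Let smf : supermartingale P F f := Mminus_supermartingale hf.
Let filF : filtration F := supermartingale_filtration smf.

Lemma ae_compensator_ge0 : {ae P, forall w, forall j, (1 <= j)%N -> 0 <= e j w}.
Proof.
apply: ae_foralln => -[|j]; first exact: aeW.
have [ej0 _] := integral_expR_increment_le smf (ltW lambda0) (he (ltn0Sn j)).
by apply: filterS ej0.
Qed.

(** This is [exp (lambda f_n)] divided by the product of the [1 + e_j] for
    [1 <= j <= n]; with logarithms the division becomes a subtraction, whose
    measurability is immediate. *)
Definition exp_process (n : nat) (w : T) : R :=
  expR (lambda * f n w - \sum_(j < n) ln (1 + Num.max (e j.+1 w) 0)).

Let measurable_F m n (X : T -> R) : (m <= n)%N -> measurable_wrt (F m) X ->
  measurable_fun [set: g_sigma_algebraType (F n)]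
    (X : g_sigma_algebraType (F n) -> R).
Proof.
move=> mn mX; apply/(measurable_wrtP (filtration_sigma filF n)) => B mB.
exact/(filtration_mono filF mn)/mX.
Qed.

Let ln_factor_measurable j n : (j <= n)%N ->
  measurable_fun [set: g_sigma_algebraType (F n)]
    (fun w : g_sigma_algebraType (F n) => ln (1 + Num.max (e j.+1 w) 0)).
Proof.
move=> jn; apply: (measurableT_comp (@measurable_ln R)).
apply: measurable_funD => //; apply: measurable_maxr => //.
by apply: measurable_F jn _; case: (he (ltn0Sn j)).
Qed.

Lemma exp_process_measurable n : measurable_wrt (F n) (exp_process n).
Proof.
apply/(measurable_wrtP (filtration_sigma filF n)).
apply: (measurableT_comp (@measurable_expR R)); apply: measurable_funB.
  apply: measurable_funM => //; apply: measurable_F (leqnn n) _.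
  exact: (supermartingale_adapted smf n).
by apply: measurable_sum => j; apply: ln_factor_measurable; exact: ltnW.
Qed.

(** The ratio of two successive values of the process is
    [exp (lambda d_(n+1)) / (1 + e_(n+1))].  Everything in the integrand at time
    [n + 1] except [exp (lambda d_(n+1))] is known at time [n] and forms the
    weight [Z]; replacing that exponential by [1 + e_(n+1)] cancels the
    denominator. *)
Lemma exp_process_decreasing n A : F n A ->
  (\int[P]_(w in A) (exp_process n.+1 w)%:E
   <= \int[P]_(w in A) (exp_process n w)%:E)%E.
Proof.
move=> FA.
have [_ step] := integral_expR_increment_le smf (ltW lambda0) (he (ltn0Sn n)).
pose Z w := exp_process n w * expR (- ln (1 + Num.max (e n.+1 w) 0)) * \1_A w.
have mZ : measurable_wrt (F n) Z.
  apply/(measurable_wrtP (filtration_sigma filF n)).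
  apply: measurable_funM; first apply: measurable_funM.
  - exact/(measurable_wrtP (filtration_sigma filF n))/exp_process_measurable.
  - apply: (measurableT_comp (@measurable_expR R)).
    apply: measurable_funN.
    exact: ln_factor_measurable.
  - apply: measurable_indic.
    by rewrite (measurable_g_measurableTypeE (filtration_sigma filF n)).
have factor_ge1 w : 1 <= 1 + Num.max (e n.+1 w) 0.
  by rewrite lerDl le_max lexx orbT.
have factor_gt0 w : 0 < 1 + Num.max (e n.+1 w) 0.
  exact: lt_le_trans (factor_ge1 w).
have fm k : measurable_fun [set: T] (f k).
  exact/measurable_EFinP/(measurable_int _ (supermartingale_integrable smf k)).
rewrite [leLHS]integral_mkcond [leRHS]integral_mkcond.
rewrite (_ : _ \_ A =
    fun w => (Z w * expR (lambda * increment f n.+1 w))%:E); last first.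
  apply/funext => w; rewrite patchE /Z indicE; case: ifPn => wA.
    rewrite mulr1 /exp_process big_ord_recr/= -!expRD /increment/=.
    by congr (expR _)%:E; ring.
  by rewrite mulr0 mul0r.
rewrite [in leRHS](_ : _ \_ A =
    fun w => (Z w * (1 + Num.max (e n.+1 w) 0))%:E); last first.
  apply/funext => w; rewrite patchE /Z indicE; case: ifPn => wA.
    by rewrite mulr1 expRN lnK ?posrE// mulrVK ?unitfE ?gt_eqF.
  by rewrite mulr0 mul0r.
apply: (le_integral_mul (filtration_sigma filF n) (filtration_sub filF (n:=n))).
- apply: (measurableT_comp (@measurable_expR R)).
  by apply: measurable_funM => //; exact: measurable_funB.
- by move=> w; exact: expR_ge0.
- apply: measurable_funD => //; apply: measurable_maxr => //.
  apply: measurable_wrt_fun (filtration_sub filF (n:=n)) _ _.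
  by case: (he (ltn0Sn n)).
- by move=> w; exact: ltW.
- exact: mZ.
- by move=> w; rewrite !mulr_ge0 ?expR_ge0.
- exact: step.
Qed.

(** At a time when [f] is at least [s] the process is at least
    [exp (lambda s) / C], while its initial value is 1. *)
Lemma probability_crossing_le (C s : R) : 0 < C ->
  {ae P, forall w, forall n, \prod_(1 <= j < n) (1 + e j w) <= C} ->
  (P (\bigcup_n [set w | (s <= f n w)%R]) <= (expR (- lambda * s) * C)%:E)%E.
Proof.
move=> C0 prodC.
pose c := expR (lambda * s) / C.
have c0 : 0 < c by rewrite divr_gt0 ?expR_gt0.
have FE n : F n [set w | s <= f n w].
  have := supermartingale_adapted smf n (measurable_itv `[s, +oo[).
  by congr (F n _); apply/seteqP; split => w /=; rewrite in_itv/= andbT.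
have := maximal_inequality (M := exp_process) (mu := P) (c := c) filF.
have mM n : measurable_fun [set: T] (exp_process n).
  apply: measurable_wrt_fun (filtration_sub filF (n:=n)) _ _.
  exact: exp_process_measurable.
move=> /(_ _ mM (fun n w => expR_ge0 _) exp_process_decreasing FE (ltW c0)).
have EM : {ae P, forall w, forall n, s <= f n w -> c <= exp_process n w}.
  apply: filterS2 prodC ae_compensator_ge0 => w prodC e0 n sf.
  rewrite /exp_process expRD expRN; apply: ler_pM.
  - exact: expR_ge0.
  - by rewrite invr_ge0 ltW.
  - by rewrite ler_expR ler_pM2l.
  rewrite lef_pV2 ?posrE ?expR_gt0// expR_sum.
  apply: le_trans (prodC n.+1); rewrite big_add1 big_mkord.
  apply: ler_prod => j _; rewrite expR_ge0/= max_l ?e0// lnK// posrE.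
  by rewrite ltr_wpDr ?e0.
move=> /(_ EM).
rewrite (_ : (fun w => (exp_process 0 w)%:E) = cst 1%E); last first.
  apply/funext => w.
  by rewrite /exp_process big_ord0 (Mminus0 hf) mulr0 subr0 expR0.
rewrite integral_cst// mul1e.
move=> /le_trans/(_ (probability_le1 P measurableT)) cP.
rewrite -(lee_pmul2l _ _ (x := c%:E)) ?lte_fin//.
apply: le_trans cP _; rewrite -EFinM lee_fin /c.
by rewrite mulNr expRN mulrACA mulVf ?gt_eqF// mulr1 divff ?gt_eqF ?expR_gt0.
Qed.

End exponential_supermartingale.

(** * The tail bound *)

(** The inequality [s < r] has to be strict: a supremum equal to [r] need not be
    attained. *)
Lemma maximal_ge_subset (T : Type) (R : realType) (f : nat -> T -> R)
    (r s : R) : s < r ->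
  [set w | (r%:E <= maximal f w)%E] `<=` \bigcup_n [set w | s <= f n w].
Proof.
move=> sr w /= rf.
have : (s%:E < maximal f w)%E by apply: lt_le_trans rf; rewrite lte_fin.
move=> /ereal_sup_gt[_ [n _ <-]]; rewrite lte_fin => sf.
by exists n => //=; exact: ltW.
Qed.

Lemma maximal_ge_measurable d (T : measurableType d) (R : realType)
    (f : nat -> T -> R) (r : R) : (forall n, measurable_fun [set: T] (f n)) ->
  measurable [set w | (r%:E <= maximal f w)%E].
Proof.
move=> mf; rewrite -[X in measurable X]setTI.
apply: emeasurable_fun_c_infty => //.
rewrite (_ : maximal f = fun w => esups (fun n => (f n w)%:E) 0%N).
  by apply: measurable_fun_esups => n; exact/measurable_EFinP.
apply/funext => w; rewrite /maximal /esups/=; congr ereal_sup.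
by apply/seteqP; split => x [n _ <-]; exists n.
Qed.

Theorem theorem8p1 (R : realType) (d : measure_display) (T : measurableType d)
    (P : probability T R) (F : nat -> set (set T)) (f : nat -> T -> R)
    (lambda : R) (e : nat -> T -> R)
    (hf : Mminus P F f)
    (hlambda : 0 < lambda)
    (hexp : forall j : nat, (1 <= j)%N ->
      ('E_P[fun w => expR (lambda * increment f j w)] < +oo)%E)
    (he : forall j : nat, (1 <= j)%N ->
      is_cond_exp P (F j.-1)
        (fun w => expR (lambda * increment f j w) - 1
                  - lambda * increment f j w)
        (e j))
    (r : R) (hr : 0 <= r) :
  (P [set w | r%:E <= maximal f w]
     <= (expR (- lambda * r))%:E
        * Lnorm P +oo (fun w => infprod1 (fun j => (1 + e j w)%R))
     <= expeR ((- lambda * r)%:E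
               + Lnorm P +oo (fun w => \sum_(1 <= j <oo) (e j w)%:E)))%E.
Proof.
have e0 := ae_compensator_ge0 hf hlambda he.
have P1 : (0 < P [set: T])%E by rewrite probability_setT lte_fin.
rewrite unlock P1.
set abs_prod := abse \o (fun w => infprod1 _).
set abs_sum := abse \o (fun w => \sum_(1 <= j <oo) _)%E.
set prod_norm := ess_sup_inf.ess_sup P abs_prod.
have prod_le : {ae P, forall w, forall n,
    ((\prod_(1 <= j < n) (1 + e j w))%:E <= prod_norm)%E}.
  apply: filterS2 e0 (ess_sup_inf.ess_sup_ge P abs_prod) => w e0 prodw n.
  apply: le_trans (prod_le_infprod1 e0 n) _.
  exact: le_trans (lee_abs _) prodw.
have prod_norm_ge1 : (1 <= prod_norm)%E.
  rewrite -(ess_sup_inf.ess_sup_cst (mu := P) 1%E P1).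
  apply/ess_sup_inf.ess_supP; apply: filterS prod_le => w /(_ 1%N).
  by rewrite big_geq.
apply/andP; split; last first.
  rewrite expeRD/= lee_pmul2l ?lte_fin ?expR_gt0//.
  apply/ess_sup_inf.ess_supP.
  apply: filterS2 e0 (ess_sup_inf.ess_sup_ge P abs_sum) => w e0 sumw /=.
  rewrite /abs_prod/= gee0_abs; last first.
    apply: le_trans (prod_le_infprod1 e0 1); by rewrite big_geq ?lee_fin.
  apply: le_trans (infprod1_le_expeR_sum e0) _.
  rewrite lee_expeR; exact: le_trans (lee_abs _) sumw.
move: prod_norm prod_norm_ge1 prod_le => [C|_ _|//]; last first.
  by rewrite gt0_muley ?leey// lte_fin expR_gt0.
rewrite lee_fin => C1 prodC.
have C0 : 0 < C by exact: lt_le_trans C1.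
have mf n : measurable_fun [set: T] (f n).
  exact/measurable_EFinP/(measurable_int _
    (supermartingale_integrable (Mminus_supermartingale hf) n)).
have crossing s : s < r ->
    (P [set w | r%:E <= maximal f w] <= (expR (- lambda * s) * C)%:E)%E.
  move=> sr; apply: le_trans (probability_crossing_le hf hlambda he s C0 _).
    rewrite le_measure ?inE//; last exact: maximal_ge_subset.
      exact: maximal_ge_measurable.
    apply: bigcupT_measurable => n.
    rewrite (_ : [set w | _] = f n @^-1` `[s, +oo[); last first.
      by apply/seteqP; split => w /=; rewrite in_itv/= andbT.
    by rewrite -[_ @^-1` _]setTI; exact: mf.
  by apply: filterS prodC => w prodC n; have := prodC n; rewrite lee_fin.
(* The level s < r is the one at which the crossing bound equals the right-hand
   side increased by eps. *)
apply/lee_addgt0Pr => eps eps0; rewrite -!EFinM -EFinD.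
set z := _ + eps.
have z0 : 0 < z by rewrite ltr_wpDl// mulr_ge0 ?expR_ge0// ltW.
have lnz : expR (ln (z / C)) = z / C by rewrite lnK// posrE divr_gt0.
apply: le_trans (crossing (- (ln (z / C) / lambda)) _) _.
  rewrite ltrNl ltr_pdivlMr// -ltr_expR lnz ltr_pdivlMr//.
  by rewrite [- r * _](_ : _ = - lambda * r) ?ltrDl//; ring.
by rewrite mulrNN mulrC mulrCA divff ?gt_eqF// mulr1 lnz mulrC divfK ?gt_eqF.
Qed.
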